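(* Assume that the matrix $M$ is invertible. Then, with $\mathbb V,\mathbb W,\Psi,\|\cdot\|_{Y,0},\hat S$ as defined in the context, $$\beta:=\inf_{\substack{v\in\mathbb V\\ \|v\|_\Omega=1}}\ \inf_{w\in\mathbb W}\ \sup_{(\boldsymbol\eta,\boldsymbol\zeta)\ne\boldsymbol 0}\frac{\Psi(v+w;\boldsymbol\eta,\boldsymbol\zeta)}{\|\boldsymbol y(\boldsymbol\eta,\boldsymbol\zeta)\|_{Y,0}}=\sqrt{\sigma_{\min}(\hat S)},$$ where $\sigma_{\min}(\hat S)$ denotes the smallest eigenvalue of the symmetric matrix $\hat S$.
   Context: Let $d\ge 2$ and let $S_d\subset\mathbb R^d$ be a nondegenerate $d$-simplex with vertices $\boldsymbol v_0,\dots,\boldsymbol v_d$ and barycentric coordinates $\lambda_0,\dots,\lambda_d$. $F_j$ is the face opposite $\boldsymbol v_j$. $\mathbb P_k(X)$ is the space of (restrictions to $X$ of) polynomials of total degree at most $k$. $\Omega\in L^1(S_d)$ is a probability density, strictly positive a.e. in the interior of $S_d$. For each $j$, the induced face density $\omega_j$ is the normalized conditional trace of $\Omega$ on $F_j$: for every $\phi$ continuous on $F_j$ (extended continuously to $S_d$), $\int_{F_j}\phi\,\omega_j\,d\boldsymbol x=\lim_{\varepsilon\to0^+}\int_{\{\lambda_j<\varepsilon\}}\phi\,\Omega\,d\boldsymbol\sigma\big/\int_{\{\lambda_j<\varepsilon\}}\Omega\,d\boldsymbol\sigma$; it is assumed that this limit exists and defines a probability density $\omega_j\in L^1(F_j)$,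 positive a.e. on $F_j$. Set $\langle f,g\rangle_\Omega=\int_{S_d}fg\,\Omega\,d\boldsymbol\sigma$, $\|f\|_\Omega^2=\langle f,f\rangle_\Omega$, and $\langle f,g\rangle_{\omega_j}=\int_{F_j}fg\,\omega_j\,d\boldsymbol x$ (functions on $S_d$ are restricted to $F_j$). $\mathbb S_2(S_d)=\{p\in\mathbb P_2(S_d):\langle p,\varphi\rangle_\Omega=0\ \forall\varphi\in\mathbb P_1(S_d)\}$, of dimension $d(d+1)/2$; $\tilde d=(d-2)(d+1)/2$. $\rho_1,\dots,\rho_{\tilde d}\in\mathbb S_2(S_d)$ are linearly independent, $\mathbb V=\operatorname{span}\{\rho_k\}$, and $\psi_0,\dots,\psi_d\in\mathbb S_2(S_d)$, $\mathbb W=\operatorname{span}\{\psi_j\}$, are such that $\mathbb S_2(S_d)=\mathbb V\oplus\mathbb W$ (direct, not necessarily orthogonal, sum). For each $j$, $q_j\in\mathbb P_2(F_j)$ satisfies $\langle q_j,\varphi\rangle_{\omega_j}=0$ for all $\varphi\in\mathbb P_1(F_j)$. Functionals: $\mathcal L_j(f)=\langle f,q_j\rangle_{\omega_j}$ ($j=0,\dots,d$), $\mathcal V_k(f)=\langle f,\rho_k\rangle_\Omega$ ($k=1,\dots,\tilde d$). Matrices: $[G]_{k\ell}=\mathcal V_k(\rho_\ell)$ (symmetric positive definite), $[C]_{ki}=\mathcal V_k(\psi_i)$, $[\tilde C]_{j\ell}=\mathcal L_j(\rho_\ell)$, $[M]_{ji}=\mathcal L_j(\psi_i)$, with $i,j=0,\dots,d$,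 $k,\ell=1,\dots,\tilde d$. For $\boldsymbol\eta\in\mathbb R^{d+1}$ (indexed $0,\dots,d$), $\boldsymbol\zeta\in\mathbb R^{\tilde d}$, $\boldsymbol y(\boldsymbol\eta,\boldsymbol\zeta)=(\boldsymbol\eta,\boldsymbol\zeta)\in Y=\mathbb R^{d+1}\times\mathbb R^{\tilde d}$, define $$\|\boldsymbol y(\boldsymbol\eta,\boldsymbol\zeta)\|_{Y,0}^2=\boldsymbol\eta^\top(M^\top M)^{-1}\boldsymbol\eta+\boldsymbol\zeta^\top G^{-1}\boldsymbol\zeta,\qquad \Psi(q;\boldsymbol\eta,\boldsymbol\zeta)=\sum_{j=0}^d\eta_j\mathcal L_j(q)+\sum_{k=1}^{\tilde d}\zeta_k\mathcal V_k(q),\quad q\in\mathbb S_2(S_d).$$ Let $K_{11}=\tilde C^\top(M^\top M)\tilde C+G^3$, $K_{12}=\tilde C^\top(M^\top M)M+G^2C$, $K_{21}=M^\top(M^\top M)\tilde C+C^\top G^2=K_{12}^\top$, $K_{22}=M^\top(M^\top M)M+C^\top GC$ (symmetric positive definite when $M$ is invertible), $S=K_{11}-K_{12}K_{22}^{-1}K_{21}$, $\hat S=G^{-1/2}SG^{-1/2}$. In the degenerate case $d=2$ ($\tilde d=0$, $\mathbb V=\{0\}$), the infimum over the empty set and $\sigma_{\min}$ of the $0\times0$ matrix are both read as $+\infty$. *)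

(* Defs.v *)
From HB Require Import structures.
From mathcomp Require Import all_boot all_order all_algebra.
From mathcomp Require Import all_classical all_reals all_analysis.
From mathcomp Require Import measurable_realfun.

Set Implicit Arguments.
Unset Strict Implicit.
Unset Printing Implicit Defensive.

Import Order.TTheory GRing.Theory Num.Theory.
Import numFieldNormedType.Exports.
Local Open Scope classical_set_scope.
Local Open Scope ring_scope.

Definition rV_display : measure_display.
Proof. exact: default_measure_display. Qed.

(* The sigma-algebra generated by the coordinates, i.e. the Borel sets of R^n. *)
Section measurable_rV.
Context {R : realType} {n : nat}.

Definition rV_coord (i : 'I_n) (x : 'rV[R]_n) : measurableTypeR R := x 0 i.

Let rV0 : g_sigma_preimage rV_coord set0.
Proof. exact: sigma_algebra0. Qed.

Let rVC A : g_sigma_preimage rV_coord A -> g_sigma_preimage rV_coord (~` A).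
Proof. exact: sigma_algebraC. Qed.

Let rV_bigcup (F : _^nat) : (forall i, g_sigma_preimage rV_coord (F i)) ->
  g_sigma_preimage rV_coord (\bigcup_i (F i)).
Proof. exact: sigma_algebra_bigcup. Qed.

HB.instance Definition _ := @isMeasurable.Build rV_display
  'rV[R]_n (g_sigma_preimage rV_coord) rV0 rVC rV_bigcup.

Lemma measurable_rV_coord (i : 'I_n) : measurable_fun [set: 'rV[R]_n] (rV_coord i).
Proof.
move=> _ Y mY; rewrite setTI; apply: sub_sigma_algebra => /=.
rewrite -bigcup_seq/=; exists i => /=; first by rewrite mem_index_enum.
by exists Y => //; rewrite setTI.
Qed.

Lemma measurable_fun_rV d (T : measurableType d) (f : T -> 'rV[R]_n) :
  (forall i, measurable_fun [set: T] (rV_coord i \o f)) ->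
  measurable_fun [set: T] f.
Proof.
move=> mf _ A.
apply: (smallest_sub (X := fun A => measurable (setT `&` f @^-1` A))).
  split => /=.
  - by rewrite preimage_set0 setI0.
  - move=> B mB; rewrite setTD setTI preimage_setC; apply: measurableC.
    by rewrite -[X in measurable X]setTI.
  - move=> F mF; rewrite preimage_bigcup setTI; apply: bigcup_measurable => k _.
    by have := mF k; rewrite setTI.
move=> B; rewrite -bigcup_seq/= => -[i _ [C mC <-]]; rewrite setTI.
by have := mf i measurableT C mC; rewrite comp_preimage.
Qed.

End measurable_rV.

(* Lebesgue measure on R^n: Lebesgue measure on R times that on R^(n-1),
   transported along R * R^(n-1) -> R^n. *)
Section lebesgue_rV.
Context {R : realType}.

Definition rV_cons n (p : measurableTypeR R * 'rV[R]_n) : 'rV[R]_n.+1 :=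
  row_mx (p.1)%:M p.2.

Definition rV_uncons n (x : 'rV[R]_n.+1) : measurableTypeR R * 'rV[R]_n :=
  (x 0 0, rsubmx (x : 'rV_(1 + n))).

Lemma rV_consK n : cancel (@rV_cons n) (@rV_uncons n).
Proof.
move=> [a x]; rewrite /rV_uncons /rV_cons row_mxKr; congr pair.
have -> : (0 : 'I_n.+1) = lshift n (0 : 'I_1) by apply/val_inj.
by rewrite (row_mxEl a%:M) mxE mulr1n.
Qed.

Lemma rV_unconsK n : cancel (@rV_uncons n) (@rV_cons n).
Proof.
move=> x; rewrite /rV_uncons /rV_cons.
suff -> : (x 0 0)%:M = lsubmx (x : 'rV_(1 + n)) by exact: (@hsubmxK _ 1 1 n x).
apply/matrixP => i j.
by rewrite !ord1 !mxE mulr1n; congr (x _ _); apply/val_inj.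
Qed.

Lemma measurable_rV_cons n : measurable_fun [set: _] (@rV_cons n).
Proof.
apply: measurable_fun_rV => i; case: (@splitP 1 n i) => [j ij|k ik].
  rewrite (_ : _ \o _ = fst) //; apply/funext => -[a x] /=.
  rewrite /rV_coord/rV_cons (_ : i = lshift n j); last exact/val_inj.
  by rewrite (row_mxEl a%:M) !ord1 mxE mulr1n.
rewrite (_ : _ \o _ = rV_coord k \o snd); last first.
  apply/funext => -[a x] /=.
  rewrite /rV_coord/rV_cons (_ : i = rshift 1 k); last exact/val_inj.
  by rewrite (row_mxEr a%:M).
by apply: measurableT_comp => //; exact: measurable_rV_coord.
Qed.

Lemma measurable_rV_uncons n : measurable_fun [set: _] (@rV_uncons n).
Proof.
apply/measurable_fun_pairP; split; first exact: (measurable_rV_coord 0).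
apply: measurable_fun_rV => i; rewrite (_ : _ \o _ = rV_coord (rshift 1 i)).
  exact: measurable_rV_coord.
by apply/funext => x; rewrite /rV_coord /= mxE.
Qed.

HB.instance Definition _ n := @isMeasurableFun.Build _ _ _ _
  (@rV_cons n) (@measurable_rV_cons n).

Section step.
Context {n : nat} (m : {sigma_finite_measure set 'rV[R]_n -> \bar R}).

Definition lebesgue_rV_step : set 'rV[R]_n.+1 -> \bar R :=
  pushforward (@lebesgue_measure R \x m)%E (@rV_cons n).

Let mu0 : lebesgue_rV_step set0 = 0%E.
Proof. exact: measure0. Qed.

Let mu_ge0 A : (0 <= lebesgue_rV_step A)%E.
Proof. exact: measure_ge0. Qed.

Let mu_sigma_additive : semi_sigma_additive lebesgue_rV_step.
Proof. exact: measure_semi_sigma_additive. Qed.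

HB.instance Definition _ := isMeasure.Build _ _ _ lebesgue_rV_step
  mu0 mu_ge0 mu_sigma_additive.

Let mu_sigma_finite : sigma_finite setT lebesgue_rV_step.
Proof.
have /sigma_finiteP[F [FT ndF Foo]] := sigma_finiteT (@lebesgue_measure R).
have /sigma_finiteP[G [GT ndG Goo]] := sigma_finiteT m.
exists (fun k => @rV_uncons n @^-1` (F k `*` G k)).
  rewrite -preimage_bigcup (_ : \bigcup_k _ = setT) ?preimage_setT//.
  apply/seteqP; split => // -[x y] _.
  have [i _ Fx] : (\bigcup_k F k) x by rewrite -FT.
  have [j _ Gy] : (\bigcup_k G k) y by rewrite -GT.
  exists (maxn i j) => //; split.
  - by move: x Fx; exact/subsetPset/ndF/leq_maxl.
  - by move: y Gy; exact/subsetPset/ndG/leq_maxr.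
move=> k; have [? ?] := Foo k; have [? ?] := Goo k; split.
  rewrite -[X in measurable X]setTI.
  by apply: measurable_rV_uncons => //; exact: measurableX.
rewrite /lebesgue_rV_step /pushforward -comp_preimage.
rewrite (_ : _ \o _ = id); last by apply/funext => p /=; rewrite rV_consK.
by rewrite preimage_id product_measure1E// lte_mul_pinfty// ge0_fin_numE.
Qed.

HB.instance Definition _ := Measure_isSigmaFinite.Build _ _ _ lebesgue_rV_step
  mu_sigma_finite.

End step.

Fixpoint lebesgue_rV n : {sigma_finite_measure set 'rV[R]_n -> \bar R} :=
  if n is k.+1 then lebesgue_rV_step (lebesgue_rV k) else \d_(0 : 'rV[R]_0).

End lebesgue_rV.

Section simplex.
Context {R : realType} {d : nat}.
Implicit Types (v : 'I_d.+1 -> 'rV[R]_d) (j : 'I_d.+1) (x : 'rV[R]_d).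

Definition affinely_independent v :=
  forall c : 'I_d.+1 -> R,
    \sum_i c i = 0 -> \sum_i c i *: v i = 0 -> forall i, c i = 0.

Definition simplex v : set 'rV[R]_d :=
  [set x | exists t : 'I_d.+1 -> R,
    [/\ forall i, 0 <= t i, \sum_i t i = 1 & x = \sum_i t i *: v i]].

Definition vertex_mx v : 'M[R]_d.+1 := \matrix_i row_mx 1%:M (v i).

(* The row (lambda_0(x), ..., lambda_d(x)) is the solution of the linear system
   \sum_i lambda_i = 1, \sum_i lambda_i *: v i = x; see [baryE]. *)
Definition bary v j x : R := (row_mx 1%:M x *m invmx (vertex_mx v)) 0 j.

Definition face v j : set 'rV[R]_d := [set x | simplex v x /\ bary v j x = 0].

Lemma mul_vertex_mx v (t : 'rV[R]_d.+1) :
  t *m vertex_mx v = row_mx (\sum_i t 0 i)%:M (\sum_i t 0 i *: v i).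
Proof.
apply/rowP => k; rewrite mxE; under eq_bigr do rewrite !mxE.
rewrite [RHS]mxE; case: splitP => l _; last first.
  by rewrite summxE; under [RHS]eq_bigr do rewrite mxE.
by rewrite !ord1 !mxE mulr1n; apply: eq_bigr => i _; rewrite mulr1.
Qed.

Lemma vertex_mx_unit v : affinely_independent v -> vertex_mx v \in unitmx.
Proof.
move=> hv; rewrite -row_free_unit -kermx_eq0; apply/rowV0P => t /sub_kermxP.
rewrite mul_vertex_mx => h.
have {h} : row_mx (\sum_i t 0 i)%:M (\sum_i t 0 i *: v i) =
    row_mx 0 0 :> 'rV_(1 + d) by rewrite row_mx0.
case/eq_row_mx => t1 tv.
apply/rowP => i; rewrite mxE; apply: hv => //.
by move/matrixP/(_ 0 0): t1; rewrite !mxE mulr1n.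
Qed.

Lemma baryE v (t : 'I_d.+1 -> R) j : affinely_independent v ->
  \sum_i t i = 1 -> bary v j (\sum_i t i *: v i) = t j.
Proof.
move=> hv t1; have := mul_vertex_mx v (\row_i t i).
under eq_bigr do rewrite mxE; under [X in row_mx _ X]eq_bigr do rewrite mxE.
by rewrite t1 /bary => <-; rewrite mulmxK ?vertex_mx_unit// mxE.
Qed.

End simplex.

(* (d-1)-dimensional surface measure on the hyperplane spanned by the face
   opposite to v_j, from the parametrization
     t |-> w_0 + \sum_(i < d-1) t_i *: (w_(i+1) - w_0)
   where w_0, ..., w_(d-1) enumerates the vertices other than v_j. *)
Section surface_measure.
Context {R : realType} {d : nat} (v : 'I_d.+1 -> 'rV[R]_d) (j : 'I_d.+1).

Definition face_vertex (k : nat) : 'rV[R]_d := v (inord (bump j k)).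

Definition face_edges : 'M[R]_(d.-1, d) :=
  \matrix_i (face_vertex i.+1 - face_vertex 0).

Definition face_param (t : 'rV[R]_d.-1) : 'rV[R]_d :=
  face_vertex 0 + t *m face_edges.

Lemma measurable_face_param : measurable_fun [set: _] face_param.
Proof.
apply: measurable_fun_rV => i.
rewrite (_ : _ \o _ = fun t => face_vertex 0 0 i +
    \sum_k rV_coord k t * face_edges k i); last first.
  by apply/funext => t; rewrite /rV_coord /= !mxE.
apply: measurable_funD => //; apply: measurable_sum => k.
by apply: measurable_funM => //; exact: measurable_rV_coord.
Qed.

HB.instance Definition _ := @isMeasurableFun.Build _ _ _ _
  face_param measurable_face_param.

Definition face_pushforward : set 'rV[R]_d -> \bar R :=
  pushforward (lebesgue_rV d.-1) face_param.

Let face_pushforward0 : face_pushforward set0 = 0%E.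
Proof. exact: measure0. Qed.

Let face_pushforward_ge0 A : (0 <= face_pushforward A)%E.
Proof. exact: measure_ge0. Qed.

Let face_pushforward_sigma_additive : semi_sigma_additive face_pushforward.
Proof. exact: measure_semi_sigma_additive. Qed.

HB.instance Definition _ := isMeasure.Build _ _ _ face_pushforward
  face_pushforward0 face_pushforward_ge0 face_pushforward_sigma_additive.

Definition gram_factor : {nonneg R} :=
  (Num.sqrt (\det (face_edges *m face_edges^T)))%:nng.

Definition surface_measure : {measure set 'rV[R]_d -> \bar R} :=
  mscale gram_factor face_pushforward.

End surface_measure.

(* Functions on X are represented by functions on R^d, of which only the values
   on X matter. *)
Section function_spaces.
Context {R : realType} {d : nat}.
Implicit Types (X : set 'rV[R]_d) (f g w : 'rV[R]_d -> R).

Definition Poly_le (k : nat) X : set ('rV[R]_d -> R) :=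
  [set f | exists c : {ffun 'I_d -> 'I_k.+1} -> R, forall x, X x ->
    f x = \sum_(m : {ffun 'I_d -> 'I_k.+1} | (\sum_i m i <= k)%N)
            c m * \prod_i x 0 i ^+ m i].

Definition Span (I : finType) X (g : I -> 'rV[R]_d -> R) :
    set ('rV[R]_d -> R) :=
  [set f | exists a : I -> R, forall x, X x -> f x = \sum_i a i * g i x].

Definition lin_indep (I : finType) X (g : I -> 'rV[R]_d -> R) :=
  forall a : I -> R, (forall x, X x -> \sum_i a i * g i x = 0) ->
    forall i, a i = 0.

Definition direct_sum X (E V W : set ('rV[R]_d -> R)) :=
  [/\ V `<=` E, W `<=` E,
      forall f, E f -> exists g h, [/\ V g, W h &
        forall x, X x -> f x = g x + h x] &
      forall f, V f -> W f -> forall x, X x -> f x = 0].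

Definition prob_density (mu : {measure set 'rV[R]_d -> \bar R}) X w :=
  [/\ mu.-integrable X (EFin \o w),
      {ae mu, forall x, X x -> 0 <= w x} &
      \int[mu]_(x in X) w x = 1].

Definition ip (mu : {measure set 'rV[R]_d -> \bar R}) X w f g : R :=
  \int[mu]_(x in X) (f x * g x * w x).

Variables (v : 'I_d.+1 -> 'rV[R]_d) (Omega : 'rV[R]_d -> R)
  (omega : 'I_d.+1 -> 'rV[R]_d -> R).

Definition ip_Omega f g := ip (lebesgue_rV d) (simplex v) Omega f g.

Definition norm_Omega f := Num.sqrt (ip_Omega f f).

Definition ip_omega j f g :=
  ip (surface_measure v j) (face v j) (omega j) f g.

(* phi ranges over all continuous functions on the simplex, hence over all
   continuous extensions of all continuous functions on the face. *)
Definition is_trace j :=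
  forall phi : 'rV[R]_d -> R, {within simplex v, continuous phi} ->
    (fun e : R =>
       (\int[lebesgue_rV d]_(x in simplex v `&` [set x | bary v j x < e])
           (phi x * Omega x)) /
       (\int[lebesgue_rV d]_(x in simplex v `&` [set x | bary v j x < e])
           Omega x)) @ 0^'+ -->
    \int[surface_measure v j]_(x in face v j) (phi x * omega j x).

Definition S2 : set ('rV[R]_d -> R) :=
  [set p | Poly_le 2 (simplex v) p /\
    forall phi, Poly_le 1 (simplex v) phi -> ip_Omega p phi = 0].

End function_spaces.

Definition dtilde (d : nat) : nat := ((d - 2) * d.+1)./2.

Section matrices.
Context {R : realType} {d : nat}.
Variables (v : 'I_d.+1 -> 'rV[R]_d) (Omega : 'rV[R]_d -> R)
  (omega : 'I_d.+1 -> 'rV[R]_d -> R)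
  (rho : 'I_(dtilde d) -> 'rV[R]_d -> R) (psi q : 'I_d.+1 -> 'rV[R]_d -> R).

Definition funL j (f : 'rV[R]_d -> R) : R := ip_omega v omega j f (q j).
Definition funV k (f : 'rV[R]_d -> R) : R := ip_Omega v Omega f (rho k).

Definition matG : 'M[R]_(dtilde d) := \matrix_(k, l) funV k (rho l).
Definition matC : 'M[R]_(dtilde d, d.+1) := \matrix_(k, i) funV k (psi i).
Definition matCt : 'M[R]_(d.+1, dtilde d) := \matrix_(j, l) funL j (rho l).
Definition matM : 'M[R]_d.+1 := \matrix_(j, i) funL j (psi i).

Definition Psi (f : 'rV[R]_d -> R) (y : 'cV[R]_d.+1 * 'cV[R]_(dtilde d)) : R :=
  \sum_j y.1 j 0 * funL j f + \sum_k y.2 k 0 * funV k f.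

Definition normY0 (y : 'cV[R]_d.+1 * 'cV[R]_(dtilde d)) : R :=
  Num.sqrt ((y.1^T *m invmx (matM^T *m matM) *m y.1) 0 0 +
            (y.2^T *m invmx matG *m y.2) 0 0).

Definition K11 := matCt^T *m (matM^T *m matM) *m matCt + matG ^+ 3.
Definition K12 := matCt^T *m (matM^T *m matM) *m matM + matG ^+ 2 *m matC.
Definition K21 := matM^T *m (matM^T *m matM) *m matCt + matC^T *m matG ^+ 2.
Definition K22 :=
  matM^T *m (matM^T *m matM) *m matM + matC^T *m matG *m matC.
Definition matS : 'M[R]_(dtilde d) := K11 - K12 *m invmx K22 *m K21.

End matrices.

Section symmetric_matrices.
Context {R : realType} {n : nat}.

Definition psdmx (A : 'M[R]_n) :=
  A^T = A /\ forall x : 'cV[R]_n, 0 <= (x^T *m A *m x) 0 0.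

(* The symmetric positive semidefinite square root, with the junk value 0
   if A is not itself symmetric positive semidefinite. *)
Definition sqrtmx (A : 'M[R]_n) : 'M[R]_n :=
  xget 0 [set B | psdmx B /\ B *m B = A].

(* The smallest eigenvalue of A, an infimum in \bar R so that it is +oo if n = 0. *)
Definition sigma_min (A : 'M[R]_n) : \bar R :=
  ereal_inf [set a%:E | a in [set a : R | eigenvalue A a]].

End symmetric_matrices.

Definition Shat {R : realType} {n : nat} (G S : 'M[R]_n) : 'M[R]_n :=
  invmx (sqrtmx G) *m S *m invmx (sqrtmx G).

(* Main.v *)
Require Import Defs.
From mathcomp Require Import all_boot all_order all_algebra.
From mathcomp Require Import all_classical all_reals all_analysis.
From mathcomp Require Import measurable_realfun ring lra complex.
Import Order.TTheory GRing.Theory Num.Theory.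
Import numFieldNormedType.Exports.
Local Open Scope classical_set_scope.
Local Open Scope ring_scope.

Set Implicit Arguments.
Unset Strict Implicit.
Unset Printing Implicit Defensive.

(* If f and g have coefficient vectors a and b on the rho_k and the psi_j, the
   values of all functionals on f + g form the vector z = X a + Y b with
   X = [Ct; G] and Y = [M; C].  By Cauchy-Schwarz the supremum is
   sqrt (z^T N z), where N = diag (M^T M, G) is the inverse of the matrix of
   normY0.  Completing the square in b turns the infimum over g into the Schur
   complement form a^T S a, and a^T G a = 1 is the unit sphere in the variable
   G^(1/2) a, so that the remaining infimum is the smallest eigenvalue of Shat.
   The matrix G is definite because a polynomial vanishing almost everywhere on
   the interior of the simplex vanishes on the simplex. *)

(** * Spectral theorem for real symmetric matrices *)

Section spectral.
Context {R : rcfType}.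

(** Over [R[i]] the matrix is Hermitian, so it is unitarily diagonalizable with real diagonal
    entries; any of these is already an eigenvalue over [R]. *)
Lemma symmetric_eigenvalue n (A : 'M[R]_n.+1) :
  A^T = A -> exists a, eigenvalue A a.
Proof.
move=> symA; pose AC : 'M[R[i]]_n.+1 := map_mx (real_complex R) A.
have hermA : AC \is hermsymmx.
  apply: realsym_hermsym.
    apply/is_hermitianmxP; rewrite expr0 scale1r map_mx_id//.
    by rewrite /AC map_trmx symA.
  by apply/mxOverP => i j; rewrite mxE; apply/complex_realP; exists (A i j).
have /orthomx_spectralP AE := hermitian_normalmx hermA.
have /mxOverP/(_ 0 0)/complex_realP[a aE] := hermitian_spectral_diag_real hermA.
(* Being a root of the characteristic polynomial is unaffected by the field embedding, so an
   eigenvector over [R[i]] suffices. *)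
exists a; rewrite eigenvalue_root_char -(fmorph_root (real_complex R)).
rewrite map_char_poly -eigenvalue_root_char; apply/eigenvalueP.
exists (row 0 (spectralmx AC)).
  rewrite -row_mul [X in _ *m X]AE !mulmxA mulmxV ?spectral_unit// mul1mx.
  apply/rowP => j; rewrite !mxE (bigD1 0)//= big1 => [|i /negPf i0].
    by rewrite addr0 mxE eqxx mulr1n aE.
  by rewrite mxE eq_sym i0 mulr0n mul0r.
apply/eqP => r0; have := spectral_unit AC.
rewrite -row_free_unit => /row_freeP[B] /(congr1 (row 0)).
rewrite row_mul r0 mul0mx => /rowP/(_ 0).
by rewrite !mxE eqxx => /esym/eqP; rewrite oner_eq0.
Qed.

Lemma dot_ge0 n (x : 'rV[R]_n) : 0 <= (x *m x^T) 0 0.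
Proof. by rewrite mxE sumr_ge0// => i _; rewrite mxE -expr2 sqr_ge0. Qed.

Lemma dot_eq0 n (x : 'rV[R]_n) : ((x *m x^T) 0 0 == 0) = (x == 0).
Proof.
apply/eqP/eqP => [|->]; last by rewrite mul0mx mxE.
rewrite mxE => /eqP; rewrite psumr_eq0 => [/allP h|i _]; last first.
  by rewrite mxE -expr2 sqr_ge0.
apply/rowP => i; have := h i (mem_index_enum _).
by rewrite mxE mulf_eq0 orbb => /eqP ->; rewrite mxE.
Qed.

Lemma dotC n (x y : 'rV[R]_n) : (x *m y^T) 0 0 = (y *m x^T) 0 0.
Proof. by rewrite !mxE; apply: eq_bigr => i _; rewrite !mxE mulrC. Qed.

(* H is the Householder reflection exchanging u with the first basis vector. *)
Lemma orthogonal_row0 n (u : 'rV[R]_n.+1) : u *m u^T = 1%:M ->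
  exists2 H : 'M[R]_n.+1, H *m H^T = 1%:M & row 0 H = u.
Proof.
move=> uu; pose e : 'rV[R]_n.+1 := delta_mx 0 0; pose w := e - u.
have [/eqP|w0] := eqVneq w 0.
  rewrite subr_eq0 => /eqP eu; exists 1%:M; first by rewrite trmx1 mulmx1.
  by rewrite row1.
have ee : e *m e^T = 1%:M.
  by apply/matrixP => i j; rewrite !ord1 /e trmx_delta mul_delta_mx !mxE.
pose c : R := (w *m w^T) 0 0.
have c0 : c != 0 by rewrite dot_eq0.
have wwE : w *m w^T = c%:M.
  by apply/matrixP => i j; rewrite !ord1 [RHS]mxE eqxx mulr1n.
pose H := 1%:M - (2 / c) *: (w^T *m w).
have HT : H^T = H by rewrite /H linearB /= trmx1 linearZ /= trmx_mul trmxK.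
have WW : w^T *m w *m (w^T *m w) = c *: (w^T *m w).
  by rewrite mulmxA -(mulmxA w^T) wwE mul_mx_scalar -scalemxAl.
(* Since [e] and [u] are unit vectors, [c] is [2 - 2 * (e *m u^T)], twice [e *m w^T]; hence the
   reflection sends [e] to [e - w = u]. *)
have we : e *m w^T = (c / 2)%:M.
  have uT : u *m e^T = e *m u^T by apply/matrixP => i j; rewrite !ord1 dotC.
  apply/matrixP => i j; rewrite !ord1 /c /w.
  rewrite linearB/= mulmxBr mulmxBl !mulmxBr ee uu uT !mxE eqxx !mulr1n.
  by field.
exists H.
  rewrite HT /H mulmxBr mulmx1 -scalemxAr mulmxBl mul1mx -scalemxAl WW.
  rewrite !scalerA -addrA -opprD -[RHS]subr0; congr (_ - _).
  rewrite -[X in _ *: (X - _)]scale1r -scalerBl scalerA -scalerDl.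
  by apply/eqP; rewrite scaler_eq0; apply/orP; left; apply/eqP; field.
rewrite rowE -/e /H mulmxBr mulmx1 -scalemxAr mulmxA we mul_scalar_mx scalerA.
have -> : 2 / c * (c / 2) = 1 by field.
by rewrite scale1r /w opprB addrC subrK.
Qed.

(** Induction on the size: with a unit eigenvector as first row of an orthogonal [H], the matrix
    [H *m A *m H^T] splits into the eigenvalue and a smaller symmetric block. *)
Theorem symmetric_spectral n (A : 'M[R]_n) : A^T = A ->
  exists (P : 'M[R]_n) (D : 'rV[R]_n), P *m P^T = 1%:M /\ A = P^T *m diag_mx D *m P.
Proof.
elim: n A => [|n IH] A symA.
  by exists 0, 0; split; apply/matrixP => -[].
have [a /eigenvalueP[w wA w0]] := symmetric_eigenvalue symA.
pose c := Num.sqrt ((w *m w^T) 0 0).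
have c_gt0 : 0 < c by rewrite sqrtr_gt0 lt_def dot_eq0 w0 dot_ge0.
have [H HH Hu] : exists2 H : 'M[R]_n.+1, H *m H^T = 1%:M & row 0 H = c^-1 *: w.
  apply: orthogonal_row0; apply/matrixP => i j; rewrite !ord1.
  rewrite linearZ/= -scalemxAl -scalemxAr scalerA -expr2 exprVn.
  by rewrite sqr_sqrtr ?dot_ge0// [LHS]mxE mulVf ?dot_eq0// mxE eqxx.
have [B defB] : exists B, B = H *m A *m H^T by eexists.
have symB : B^T = B by rewrite defB !trmx_mul trmxK symA mulmxA.
have HtH : H^T *m H = 1%:M by apply: mulmx1C.
have AB : A = H^T *m B *m H.
  by rewrite defB !mulmxA HtH mul1mx -mulmxA HtH mulmx1.
(* Row 0 of [H] is a left eigenvector of [A], so row 0 of [B] has only its corner entry; by symmetry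
   so does column 0. *)
have B0 : row 0 B = a *: delta_mx 0 0.
  rewrite defB !row_mul Hu -scalemxAl wA scalerA mulrC -scalerA -Hu -scalemxAl.
  by rewrite -row_mul HH row1.
have Bl j : B 0 j = a * (0 == j)%:R.
  by move/rowP: B0 => /(_ j); rewrite !mxE eqxx eq_sym.
pose B1 : 'M[R]_(1 + n) := B.
have BE : B1 = block_mx a%:M 0 0 (drsubmx B1).
  rewrite -[LHS]submxK; congr block_mx.
  - apply/matrixP => i j; rewrite !ord1 !mxE.
    have -> : lshift n (0 : 'I_1) = 0 by apply/val_inj.
    by rewrite Bl eqxx mulr1 mulr1n.
  - apply/matrixP => i j; rewrite !ord1 !mxE.
    have -> : lshift n (0 : 'I_1) = 0 by apply/val_inj.
    by rewrite Bl mulr0.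
  - apply/matrixP => i j; rewrite !ord1 !mxE.
    have -> : lshift n (0 : 'I_1) = 0 by apply/val_inj.
    by rewrite -[B1]symB mxE Bl mulr0.
have [|P [D [PP DE]]] := IH (drsubmx B1).
  by rewrite trmx_drsub /B1 symB.
pose Q : 'M[R]_(1 + n) := block_mx 1%:M 0 0 P.
pose E : 'rV[R]_(1 + n) := row_mx a%:M D.
have QQ : Q *m Q^T = 1%:M.
  rewrite tr_block_mx mulmx_block !trmx0 !mulmx0 !mul0mx !addr0 !add0r PP trmx1 mulmx1.
  by rewrite -scalar_mx_block.
have BQ : B1 = Q^T *m diag_mx E *m Q.
  rewrite BE tr_block_mx diag_mx_row !mulmx_block.
  rewrite !trmx0 !(mulmx0, mul0mx, addr0, add0r) trmx1 mulmx1 mul1mx -DE.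
  by congr block_mx; apply/matrixP => i j; rewrite !ord1 !mxE.
exists ((Q : 'M[R]_n.+1) *m H), E; split.
  by rewrite trmx_mul mulmxA -(mulmxA _ H) HH mulmx1.
rewrite AB trmx_mul -!mulmxA; congr (_ *m _); rewrite !mulmxA; congr (_ *m _).
exact: BQ.
Qed.
End spectral.

(** * Definite quadratic forms, matrix square roots and Rayleigh quotients *)

Section quadratic_forms.
Context {R : realType}.

Definition pdmx n (A : 'M[R]_n) :=
  A^T = A /\ forall x : 'cV[R]_n, x != 0 -> 0 < (x^T *m A *m x) 0 0.

Lemma pdmx_psdmx n (A : 'M[R]_n) : pdmx A -> psdmx A.
Proof.
move=> [symA posA]; split => // x; have [->|/posA/ltW//] := eqVneq x 0.
by rewrite mulmx0 mxE.
Qed.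

Lemma pdmx_unit n (A : 'M[R]_n) : pdmx A -> A \in unitmx.
Proof.
move=> [symA posA]; rewrite -row_free_unit -kermx_eq0; apply/rowV0P => x /sub_kermxP xA.
apply/eqP/negP => /negP x0; have := posA x^T; rewrite trmx_eq0 trmxK => /(_ x0).
by rewrite xA mul0mx mxE ltxx.
Qed.

(** The form of the inverse at [x] is the form of [A] at [invmx A *m x]. *)
Lemma pdmx_inv n (A : 'M[R]_n) : pdmx A -> pdmx (invmx A).
Proof.
move=> pdA; have uA := pdmx_unit pdA; have [symA posA] := pdA.
have symV : (invmx A)^T = invmx A by rewrite trmx_inv symA.
split=> // x x0; rewrite -[X in 0 < X](_ : ((invmx A *m x)^T *m A *m (invmx A *m x)) 0 0 = _).
  apply: posA; apply: contra x0 => /eqP /(congr1 (mulmx A)).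
  by rewrite mulmxA mulmxV// mul1mx mulmx0 => ->.
by rewrite trmx_mul symV !mulmxA mulmxKV.
Qed.

Lemma mulmx_tr_pdmx n (A : 'M[R]_n) : A \in unitmx -> pdmx (A^T *m A).
Proof.
move=> uA; split=> [|x x0]; first by rewrite trmx_mul trmxK.
have -> : x^T *m (A^T *m A) *m x = (A *m x)^T *m ((A *m x)^T)^T.
  by rewrite trmxK trmx_mul !mulmxA.
rewrite lt_def dot_ge0 dot_eq0 trmx_eq0 andbT.
apply: contra x0 => /eqP /(congr1 (mulmx (invmx A))).
by rewrite mulKmx// mulmx0 => ->.
Qed.

Lemma block_diag_pdmx m n (A : 'M[R]_m) (B : 'M[R]_n) :
  pdmx A -> pdmx B -> pdmx (block_mx A 0 0 B).
Proof.
move=> pdA pdB; have [symA posA] := pdA; have [symB posB] := pdB.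
split=> [|x x0]; first by rewrite tr_block_mx symA symB !trmx0.
rewrite -[x]vsubmxK tr_col_mx mul_row_block !mulmx0 addr0 add0r mul_row_col mxE.
have [_ psdA] := pdmx_psdmx pdA; have [_ psdB] := pdmx_psdmx pdB.
have [u0|u0] := eqVneq (usubmx x) 0.
  apply: ltr_wpDl => //; apply: posB; apply: contra x0 => /eqP d0.
  by rewrite -[x]vsubmxK u0 d0 col_mx0.
by apply: ltr_wpDr => //; apply: posA.
Qed.

Lemma gram_pdmx m n (N : 'M[R]_m) (Y : 'M[R]_(m, n)) :
  pdmx N -> (forall x : 'cV_n, Y *m x = 0 -> x = 0) -> pdmx (Y^T *m N *m Y).
Proof.
move=> [symN posN] injY; split=> [|x x0].
  by rewrite !trmx_mul trmxK symN mulmxA.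
have -> : x^T *m (Y^T *m N *m Y) *m x = (Y *m x)^T *m N *m (Y *m x).
  by rewrite trmx_mul !mulmxA.
by apply: posN; apply: contra x0 => /eqP/injY ->.
Qed.

Lemma tr11 (A : 'M[R]_1) : A^T = A.
Proof. by apply/matrixP => i j; rewrite !ord1 mxE. Qed.

(** Completing the square in [b]: the vector [c] solves [K *m c = Y^T *m N *m X *m a], so the cross
    terms are absorbed into the form of [K] at [b + c], and [b = - c] is the minimizer when [K] is
    definite. *)
Lemma schur_complement_form m n p (N : 'M[R]_m) (X : 'M[R]_(m, n)) (Y : 'M[R]_(m, p))
    (a : 'cV[R]_n) (b : 'cV[R]_p) :
  let K := Y^T *m N *m Y in
  let c := invmx K *m (Y^T *m N *m X) *m a in
  N^T = N -> K \in unitmx ->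
  (X *m a + Y *m b)^T *m N *m (X *m a + Y *m b) =
  a^T *m (X^T *m N *m X - X^T *m N *m Y *m invmx K *m (Y^T *m N *m X)) *m a +
  (b + c)^T *m K *m (b + c).
Proof.
move=> K c symN uK; have symK : K^T = K by rewrite /K !trmx_mul trmxK symN mulmxA.
have trD q (x y : 'cV[R]_q) : (x + y)^T = x^T + y^T by apply/matrixP => i j; rewrite !mxE.
have Kc : K *m c = Y^T *m N *m X *m a by rewrite /c !mulmxA mulmxV// mul1mx.
have cK : c^T *m K = a^T *m X^T *m N *m Y.
  by rewrite -[LHS]trmxK trmx_mul symK trmxK Kc !trmx_mul trmxK symN !mulmxA.
have -> : (b + c)^T *m K *m (b + c) =
    b^T *m K *m b + b^T *m (K *m c) + c^T *m K *m b + c^T *m K *m c.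
  by rewrite trD !mulmxDl !mulmxDr !mulmxA !addrA.
have -> : a^T *m (X^T *m N *m X - X^T *m N *m Y *m invmx K *m (Y^T *m N *m X)) *m a =
    a^T *m X^T *m N *m X *m a - c^T *m K *m c.
  by rewrite cK /c mulmxBr mulmxBl !mulmxA.
rewrite cK Kc.
have -> : (X *m a + Y *m b)^T *m N *m (X *m a + Y *m b) =
   a^T *m X^T *m N *m X *m a + a^T *m X^T *m N *m Y *m b + b^T *m Y^T *m N *m X *m a
   + b^T *m K *m b.
  by rewrite trD !trmx_mul !mulmxDl !mulmxDr /K !mulmxA !addrA.
rewrite [X in _ = _ + X]addrC [RHS]addrA subrK -!addrA; congr (_ + _).
by rewrite addrA [RHS]addrC -!addrA addrCA !mulmxA.
Qed.

(** The upper bound is Cauchy-Schwarz for [invmx N], as [y^T *m z] pairs [y] with [N *m z] in that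
    form; equality holds at [y = N *m z]. Positive size keeps the supremum from ranging over the
    empty set. *)
Lemma pdmx_ratio_sup n (N : 'M[R]_n) (z : 'cV[R]_n) : (0 < n)%N -> pdmx N ->
  ereal_sup [set ((y^T *m z) 0 0 / Num.sqrt ((y^T *m invmx N *m y) 0 0))%:E
            | y in [set y : 'cV[R]_n | y != 0]] =
  (Num.sqrt ((z^T *m N *m z) 0 0))%:E.
Proof.
case: n N z => // n N z _ pdN; have uN := pdmx_unit pdN.
have [symV posV] := pdmx_inv pdN; have [symN posN] := pdN.
apply/eqP; rewrite eq_le; apply/andP; split.
  apply: ge_ereal_sup => _ [y /= y0 <-]; rewrite lee_fin.
  have q0 := posV y y0; rewrite ler_pdivrMr ?sqrtr_gt0//.
  have [yz0|yz0] := ltP ((y^T *m z) 0 0) 0.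
    by rewrite (le_trans (ltW yz0))// mulr_ge0 ?sqrtr_ge0.
  rewrite -sqrtrM; last by have [_] := pdmx_psdmx pdN; apply.
  rewrite -[leLHS]ger0_norm// -sqrtr_sqr ler_wsqrtr//.
  (* The form of N^-1 at t y - N z is least for t = s / q; that its minimum is
     nonnegative is Cauchy-Schwarz. *)
  set q := (y^T *m invmx N *m y) 0 0 in q0 *; set s := (y^T *m z) 0 0.
  set r := (z^T *m N *m z) 0 0; pose t := s / q.
  have [_ /(_ (t *: y - N *m z))] := pdmx_psdmx (pdmx_inv pdN).
  have -> : ((t *: y - N *m z)^T *m invmx N *m (t *: y - N *m z)) 0 0 =
      t ^+ 2 * q - 2 * t * s + r.
    have E : (t *: y - N *m z)^T *m invmx N *m (t *: y - N *m z) =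
        (t ^+ 2) *: (y^T *m invmx N *m y) - t *: (y^T *m z)
        - t *: (y^T *m z)^T + z^T *m N *m z.
      have -> : (t *: y - N *m z)^T = t *: y^T - z^T *m N.
        by apply/matrixP => i j; rewrite -{2}symN -trmx_mul !mxE.
      rewrite !mulmxBl !mulmxBr -!scalemxAl -!scalemxAr scalerA -expr2.
      by rewrite !mulmxA mulmxKV// mulmxK// trmx_mul trmxK opprB addrA addrAC.
    rewrite {}E tr11 /q /s /r.
    move: (t) (y^T *m invmx N *m y) (y^T *m z) (z^T *m N *m z) => u A B C.
    by rewrite !mxE; ring.
  rewrite /t => h; have : 0 <= q * ((s / q) ^+ 2 * q - 2 * (s / q) * s + r).
    by rewrite mulr_ge0// ltW.
  have -> : q * ((s / q) ^+ 2 * q - 2 * (s / q) * s + r) = r * q - s ^+ 2.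
    by field; rewrite gt_eqF.
  by rewrite subr_ge0.
(* For [z = 0] the maximizer [N *m z] is not admissible, but every nonzero vector gives the ratio
   0. *)
have [z0|z0] := eqVneq z 0.
  apply: ereal_sup_ubound; exists (delta_mx 0 0) => /=.
    apply/eqP => /matrixP/(_ 0 0)/eqP; rewrite !mxE !eqxx/= oner_eq0//.
  by rewrite z0 !mulmx0 [in LHS]mxE [in RHS]mxE mul0r sqrtr0.
apply: ereal_sup_ubound; exists (N *m z) => /=.
  by apply: contra z0 => /eqP/(congr1 (mulmx (invmx N))); rewrite mulKmx// mulmx0 => ->.
have r0 := posN z z0.
rewrite trmx_mul symN !mulmxA mulmxK// -{1}(sqr_sqrtr (ltW r0)) expr2 mulfK//.
by rewrite gt_eqF// sqrtr_gt0.
Qed.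

(** Diagonalize orthogonally and take square roots of the diagonal entries. *)
Lemma psdmx_sqrt n (A : 'M[R]_n) : psdmx A -> exists B, psdmx B /\ B *m B = A.
Proof.
move=> [symA posA]; have [P [D [PP AE]]] := symmetric_spectral symA.
pose E : 'rV[R]_n := \row_i Num.sqrt (D 0 i).
(* [D 0 i] is the value of the form of [A] at the transpose of row [i] of [P]. *)
have D0 i : 0 <= D 0 i.
  have := posA (P^T *m delta_mx i 0); rewrite AE trmx_mul trmxK !mulmxA.
  rewrite -(mulmxA _ P P^T) PP mulmx1 -(mulmxA _ P P^T) PP mulmx1.
  rewrite -mulmxA -colE trmx_delta -rowE !mxE eqxx mulr1n//.
exists (P^T *m diag_mx E *m P); split.
  split=> [|x]; first by rewrite !trmx_mul trmxK tr_diag_mx mulmxA.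
  have -> : x^T *m (P^T *m diag_mx E *m P) *m x = (P *m x)^T *m diag_mx E *m (P *m x).
    by rewrite trmx_mul !mulmxA.
  move: (P *m x) => u; rewrite mxE sumr_ge0// => i _.
  rewrite mul_mx_diag !mxE mulrAC -expr2 mulr_ge0 ?sqr_ge0 ?sqrtr_ge0//.
rewrite !mulmxA -(mulmxA _ P P^T) PP mulmx1 [RHS]AE; congr (_ *m _).
rewrite -mulmxA; congr (_ *m _); rewrite mulmx_diag; congr diag_mx.
by apply/rowP => i; rewrite !mxE -expr2 sqr_sqrtr.
Qed.

(** Existence of a root rules out the default value 0 of [sqrtmx]. *)
Lemma sqrtmxP n (A : 'M[R]_n) :
  psdmx A -> psdmx (sqrtmx A) /\ sqrtmx A *m sqrtmx A = A.
Proof. by move=> /psdmx_sqrt[B AB]; rewrite /sqrtmx; case: xgetP => // /(_ B). Qed.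

(** In the coordinates [P *m x] the form is diagonal, so its smallest diagonal entry bounds it below
    on unit vectors, with equality at the corresponding row of [P]. *)
Lemma sigma_min_rayleigh n (A : 'M[R]_n) : (0 < n)%N -> A^T = A ->
  exists a, [/\ sigma_min A = a%:E,
    forall x : 'cV_n, a * (x^T *m x) 0 0 <= (x^T *m A *m x) 0 0 &
    exists2 x : 'cV_n, x^T *m x = 1%:M & (x^T *m A *m x) 0 0 = a].
Proof.
case: n A => // n A _ symA; have [P [D [PP AE]]] := symmetric_spectral symA.
have PtP := mulmx1C PP.
pose k := [arg min_(i < ord0) D 0 i]%O; pose a := D 0 k.
have amin i : a <= D 0 i by rewrite /a /k; case: arg_minP => // j _; apply.
have AP : P *m A = diag_mx D *m P by rewrite AE !mulmxA PP mul1mx.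
have ray (x : 'cV_n.+1) : a * (x^T *m x) 0 0 <= (x^T *m A *m x) 0 0.
  have -> : x^T *m x = (P *m x)^T *m (P *m x).
    by rewrite trmx_mul mulmxA -(mulmxA _ P^T) PtP mulmx1.
  have -> : x^T *m A *m x = (P *m x)^T *m diag_mx D *m (P *m x).
    by rewrite trmx_mul {1}AE !mulmxA.
  move: (P *m x) => u; rewrite !mxE mulr_sumr ler_sum// => i _.
  rewrite mul_mx_diag !mxE [leRHS]mulrAC -[leLHS]mulrC ler_wpM2l//.
  by rewrite -expr2 sqr_ge0.
exists a; split => //; last first.
  exists (P^T *m delta_mx k 0).
    rewrite trmx_mul trmxK mulmxA -(mulmxA _ P) PP mulmx1.
    by apply/matrixP => i j; rewrite !ord1 trmx_delta mul_delta_mx !mxE.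
  rewrite trmx_mul trmxK -mulmxA -(mulmxA _ P) (mulmxA P A) AP !mulmxA -(mulmxA _ P P^T).
  rewrite PP mulmx1 -mulmxA -colE trmx_delta -rowE !mxE eqxx mulr1n//.
apply/eqP; rewrite eq_le; apply/andP; split.
  apply: ereal_inf_lbound; exists a => //=; apply/eigenvalueP; exists (row k P).
    rewrite -row_mul AP row_mul; apply/rowP => j; rewrite !mxE (bigD1 k)//= big1.
      by rewrite !mxE eqxx mulr1n addr0.
    by move=> i /negPf ik; rewrite !mxE eq_sym ik mulr0n mul0r.
  apply/eqP => r0; move/(congr1 (row k)): PP.
  rewrite row_mul r0 mul0mx => /rowP/(_ k).
  by rewrite !mxE eqxx => /esym/eqP; rewrite oner_eq0.
(* Evaluating the Rayleigh bound at an eigenvector for [b] gives [a <= b]. *)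
apply: le_ereal_inf_tmp => _ [b /= /eigenvalueP[w wA w0] <-]; rewrite lee_fin.
have := ray w^T; rewrite trmxK wA -scalemxAl [in X in _ <= X]mxE.
by rewrite ler_pM2r// lt_def dot_eq0 w0 dot_ge0.
Qed.

Lemma sigma_min0 (A : 'M[R]_0) : sigma_min A = +oo%E.
Proof.
rewrite /sigma_min (_ : [set a | _] = set0) ?image_set0 ?ereal_inf0//.
apply/seteqP; split => // a /= /eigenvalueP[w _]; by rewrite (thinmx0 w) eqxx.
Qed.
End quadratic_forms.

(** * Null sets of Lebesgue measure contain no nonempty open set *)

Section lebesgue.
Context {R : realType}.

(** The set is a product of intervals, built one coordinate at a time along the recursive definition
    of the measure; in dimension 0 it is the single point, of Dirac mass 1. *)
Lemma lebesgue_rV_box_gt0 n (x : 'rV[R]_n) (e : R) : 0 < e ->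
  exists U : set 'rV[R]_n, [/\ measurable U, (0 < lebesgue_rV n U)%E &
    forall y, U y -> forall i, `|x 0 i - y 0 i| < e].
Proof.
move=> e0; elim: n x => [x|n IH x].
  exists setT; split => //; last by move=> y _ [].
  by rewrite /= diracT lte_fin.
have [V [mV V0 xV]] := IH (rV_uncons x).2.
pose I : set (measurableTypeR R) := [set` `]x 0 0 - e, x 0 0 + e[].
have mI : measurable I by exact: measurable_itv.
have I0 : (0 < lebesgue_measure I)%E.
  rewrite /I lebesgue_measure_itv/= lte_fin ifT; last by lra.
  by rewrite -EFinB lte_fin; lra.
exists (@rV_uncons R n @^-1` (I `*` V)); split.
- rewrite -[X in measurable X]setTI.
  by apply: measurable_rV_uncons => //; exact: measurableX.
- rewrite /= /lebesgue_rV_step /pushforward -comp_preimage.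
  rewrite (_ : _ \o _ = id); last by apply/funext => p /=; rewrite rV_consK.
  by rewrite preimage_id product_measure1E// mule_gt0.
- move=> y [/= yI Vy] i; move: yI; rewrite /I /= in_itv/= => /andP[yl yr].
  case: (@splitP 1 n i) => [j ij|k ik].
    have -> : i = 0 by apply/val_inj; move: ij; rewrite ord1.
    by rewrite ltr_norml; apply/andP; split; lra.
  have -> : i = rshift 1 k by apply/val_inj.
  by have := xV _ Vy k; rewrite /= !mxE.
Qed.

(** Balls of row vectors are taken entrywise, so a ball around a point of [U] contains a box of
    positive measure. *)
Lemma lebesgue_rV_negligible_open n (N U : set 'rV[R]_n) :
  (lebesgue_rV n).-negligible N -> open U -> U `<=` N -> U = set0.
Proof.
move=> [M [mM M0 NM]] oU UN; apply/seteqP; split => // x Ux /=.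
have [e e0 xe] : nbhs_ball x U by apply/nbhs_ballP; exact: oU.
have [V [mV V0 xV]] := lebesgue_rV_box_gt0 x e0.
suff V00 : lebesgue_rV n V = 0%E by rewrite V00 ltxx in V0.
apply: (subset_measure0 _ _ _ M0) => // y Vy; apply/NM/UN/xe.
by split => // i j; rewrite !ord1; exact: xV.
Qed.
End lebesgue.

(** * Continuity of finite sums and products *)

Section continuity.
Context {R : realType} {T : topologicalType} {I : Type}.

Lemma continuous_sumr (r : seq I) (P : pred I) (F : I -> T -> R) :
  (forall i, continuous (F i)) -> continuous (fun x => \sum_(i <- r | P i) F i x).
Proof.
move=> cF; apply: (continuous_big (P := P)) => [[u w]|i _]; last exact: cF.
exact: add_continuous.
Qed.

Lemma continuous_prodr (r : seq I) (P : pred I) (F : I -> T -> R) :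
  (forall i, continuous (F i)) -> continuous (fun x => \prod_(i <- r | P i) F i x).
Proof.
move=> cF; apply: (continuous_big (P := P)) => [[u w]|i _]; last exact: cF.
exact: mul_continuous.
Qed.
End continuity.

(** * Barycentric coordinates; measurability and interior of the simplex *)

Section simplex.
Context {R : realType} {d : nat} (v : 'I_d.+1 -> 'rV[R]_d).
Hypothesis hv : affinely_independent v.

Lemma bary_mx (x : 'rV[R]_d) :
  row_mx (\sum_i bary v i x)%:M (\sum_i bary v i x *: v i) = row_mx 1%:M x.
Proof.
rewrite -[RHS](mulmxKV (vertex_mx_unit hv)) mul_vertex_mx.
by congr row_mx.
Qed.

Lemma sum_bary (x : 'rV[R]_d) : \sum_i bary v i x = 1.
Proof.
by have /eq_row_mx[/matrixP/(_ 0 0)] := bary_mx x; rewrite !mxE.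
Qed.

Lemma sum_baryZ (x : 'rV[R]_d) : \sum_i bary v i x *: v i = x.
Proof. by have /eq_row_mx[] := bary_mx x. Qed.

Lemma simplexE : simplex v = [set x | forall j, 0 <= bary v j x].
Proof.
apply/seteqP; split => x /=.
  by move=> [t [t0 t1 ->]] j; rewrite baryE.
by move=> x0; exists (bary v ^~ x); split; rewrite ?sum_bary ?sum_baryZ.
Qed.

Lemma baryD1 (s t : R) (x y : 'rV[R]_d) j : s + t = 1 ->
  bary v j (s *: x + t *: y) = s * bary v j x + t * bary v j y.
Proof.
move=> st; rewrite -{1}(sum_baryZ x) -{1}(sum_baryZ y) !scaler_sumr -big_split/=.
under eq_bigr do rewrite !scalerA -scalerDl.
by rewrite baryE// big_split/= -!mulr_sumr !sum_bary !mulr1.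
Qed.

(** This form makes measurability and continuity of the coordinates immediate. *)
Lemma bary_affine j : exists (b : R) (c : 'I_d -> R),
  bary v j = fun x => b + \sum_i x 0 i * c i.
Proof.
pose W : 'M[R]_(1 + d, d.+1) := invmx (vertex_mx v).
exists (usubmx W 0 j), (fun i => dsubmx W i j); apply/funext => x.
have -> : bary v j x = (row_mx 1%:M x *m W) 0 j by [].
rewrite -[W in LHS]vsubmxK mul_row_col mul1mx mxE; congr (_ + _).
by rewrite mxE.
Qed.

Lemma measurable_bary j : measurable_fun [set: 'rV[R]_d] (bary v j).
Proof.
have [b [c ->]] := bary_affine j; apply: measurable_funD => //.
apply: measurable_sum => i; apply: measurable_funM => //.
exact: measurable_rV_coord.
Qed.

Lemma continuous_bary j : continuous (bary v j).
Proof.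
have [b [c ->]] := bary_affine j; move=> x.
apply: continuousD; first exact: cst_continuous.
suff: continuous (fun y : 'rV[R]_d => \sum_i y 0 i * c i) by apply.
apply: continuous_sumr => i y; apply: continuousM; last exact: cst_continuous.
exact: coord_continuous.
Qed.

Lemma measurable_simplex : measurable (simplex v).
Proof.
rewrite simplexE.
have -> : [set x | forall j, 0 <= bary v j x] =
    \bigcap_(j in [set: 'I_d.+1]) (bary v j @^-1` `[0, +oo[).
  apply/seteqP; split => x /= h j; first by rewrite /= in_itv/= andbT.
  by have := h j I; rewrite /= in_itv/= andbT.
apply: fin_bigcap_measurable => // j _; rewrite -[X in measurable X]setTI.
by apply: (measurable_bary j measurableT); exact: measurable_itv.
Qed.

Lemma measurable_face j : measurable (face v j).
Proof.
have -> : face v j = simplex v `&` bary v j @^-1` [set 0].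
  by apply/seteqP; split => x [].
apply: measurableI; first exact: measurable_simplex.
rewrite -[X in measurable X]setTI.
by apply: (measurable_bary j measurableT); exact: measurable_set1.
Qed.

(** A concrete stand-in for the interior: it is open, lies in the interior and is dense in the
    simplex. *)
Definition bary_pos : set 'rV[R]_d := [set x | forall j, 0 < bary v j x].

Lemma open_bary_pos : open bary_pos.
Proof.
rewrite openE => x xpos; 
apply: (@filter_forall _ _ (fun j y => 0 < bary v j y) (nbhs x)) => j.
have pos : nbhs (bary v j x) [set t | 0 < t] by exact: lt_nbhsr.
have h := continuous_bary pos. exact: h.
Qed.

Lemma bary_pos_interior : bary_pos `<=` (simplex v)°.
Proof.
rewrite -open_subsetE; last exact: open_bary_pos.
by rewrite simplexE => x xpos j; exact/ltW/xpos.
Qed.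

Lemma simplex_closure_bary_pos : simplex v `<=` closure bary_pos.
Proof.
move=> x; rewrite simplexE => /= x0 B xB.
(* x is approached along the segment from the barycenter c. *)
pose c := \sum_i d.+1%:R^-1 *: v i.
have c0 j : 0 < bary v j c.
  rewrite baryE ?invr_gt0 ?ltr0n//.
  by rewrite sumr_const card_ord -[LHS]mulr_natr mulVf// pnatr_eq0.
pose g (t : R) := (1 - t) *: x + t *: c.
have g0 : g 0 = x by rewrite /g subr0 scale1r scale0r addr0.
have gc : g t @[t --> 0^'+] --> x.
  rewrite -{}g0; apply: cvg_at_right_filter.
  apply: cvgD; apply: cvgZ; try exact: cvg_cst; last exact: cvg_id.
  by apply: cvgB; [exact: cvg_cst|exact: cvg_id].
have [t [Bt [t0 t1]]] : exists t, B (g t) /\ (0 < t /\ t < 1).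
  apply: (@filter_ex _ (0 : R)^'+).
  by apply: filterI; [exact: gc|apply: filterI]; [exact: nbhs_right_gt|exact: nbhs_right_lt].
exists (g t); split => // j; rewrite baryD1 ?subrK//.
by rewrite ltr_wpDl ?mulr_ge0 ?subr_ge0 ?(ltW t1)// mulr_gt0.
Qed.
End simplex.

(** * Polynomials on the simplex and weighted inner products *)

Section polynomials.
Context {R : realType} {d : nat}.
Implicit Types (X : set 'rV[R]_d) (f g w : 'rV[R]_d -> R).

Lemma Poly_leS k X Y f : X `<=` Y -> Poly_le k Y f -> Poly_le k X f.
Proof. by move=> XY [c fc]; exists c => x /XY/fc. Qed.

Lemma Poly_le_sum (I : finType) k X (a : I -> R) (f : I -> 'rV[R]_d -> R) :
  (forall i, Poly_le k X (f i)) -> Poly_le k X (fun x => \sum_i a i * f i x).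
Proof.
move=> /choice[c fc]; exists (fun m => \sum_i a i * c i m) => x Xx.
under eq_bigr do rewrite (fc _ x Xx) mulr_sumr.
rewrite exchange_big/=; apply: eq_bigr => m _; rewrite mulr_suml.
by apply: eq_bigr => i _; rewrite mulrA.
Qed.

(** Outside [X] the function [f] is arbitrary, so continuity is available only for the polynomial
    [p] that it agrees with on [X]. *)
Lemma Poly_le_continuous k X f : Poly_le k X f ->
  exists2 p : 'rV[R]_d -> R, continuous p & {in X, f =1 p}.
Proof.
move=> [c fc]; exists (fun x => \sum_(m : {ffun 'I_d -> 'I_k.+1} | (\sum_i m i <= k)%N)
    c m * \prod_i x 0 i ^+ m i); last by move=> x /set_mem/fc.
apply: continuous_sumr => m x; apply: continuousM; first exact: cst_continuous.
suff : continuous (fun x : 'rV[R]_d => \prod_i x 0 i ^+ m i) by apply.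
apply: continuous_prodr => i y.
apply: (@continuous_comp _ _ _ (fun y : 'rV[R]_d => y 0 i) (fun t => t ^+ m i)).
  exact: coord_continuous.
exact: exprn_continuous.
Qed.

Lemma measurable_Poly_le k X f : Poly_le k X f -> measurable_fun X f.
Proof.
move=> [c fc]; apply: (eq_measurable_fun (fun x : 'rV[R]_d =>
   \sum_(m : {ffun 'I_d -> 'I_k.+1} | (\sum_i m i <= k)%N) c m * \prod_i x 0 i ^+ m i)).
  by move=> x /set_mem/fc.
under eq_fun do rewrite -big_filter.
apply: measurable_sum => m; apply: measurable_funM => //; apply: measurable_prod => i _.
apply: measurable_funX; apply: measurable_funTS; exact: measurable_rV_coord.
Qed.

Lemma simplex_coord_bound (v : 'I_d.+1 -> 'rV[R]_d) x i : simplex v x ->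
  `|x 0 i| <= \sum_k `|v k 0 i|.
Proof.
move=> [t [t0 t1 ->]]; rewrite summxE (le_trans (ler_norm_sum _ _ _))// ler_sum// => k _.
rewrite mxE normrM ger0_norm// ler_piMl// -t1 (bigD1 k)//= lerDl sumr_ge0//.
Qed.

Lemma Poly_le_bounded k (v : 'I_d.+1 -> 'rV[R]_d) X f : X `<=` simplex v ->
  Poly_le k X f -> [bounded f x | x in X].
Proof.
move=> Xv [c fc].
exists (\sum_(m : {ffun 'I_d -> 'I_k.+1} | (\sum_i m i <= k)%N)
    `|c m| * \prod_i (\sum_l `|v l 0 i|) ^+ m i); split; first exact: num_real.
move=> M /ltW ltM x Xx; apply: le_trans ltM; rewrite (fc x Xx).
rewrite (le_trans (ler_norm_sum _ _ _))// ler_sum// => m _.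
rewrite normrM ler_wpM2l// normr_prod ler_prod// => i _; rewrite normr_ge0/= normrX.
by rewrite lerXn2r ?nnegrE ?sumr_ge0// simplex_coord_bound//; exact: Xv.
Qed.

Section inner_product.
Variables (v : 'I_d.+1 -> 'rV[R]_d) (mu : {measure set 'rV[R]_d -> \bar R})
  (X : set 'rV[R]_d) (w : 'rV[R]_d -> R).
Hypotheses (mX : measurable X) (Xv : X `<=` simplex v)
  (iw : mu.-integrable X (EFin \o w)).

(** Polynomials are bounded and measurable on subsets of the simplex, and the weight is
    integrable. *)
Lemma ip_integrable k l f g : Poly_le k X f -> Poly_le l X g ->
  mu.-integrable X (EFin \o (fun x => f x * g x * w x)).
Proof.
move=> pf pg.
have := @integrableMr _ _ _ mu _ mX _ _ (measurable_Poly_le pg) (Poly_le_bounded Xv pg) iw.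
move=> /(@integrableMr _ _ _ mu _ mX _ _ (measurable_Poly_le pf) (Poly_le_bounded Xv pf)).
by apply: eq_integrable => // x _; rewrite /= -!EFinM mulrA.
Qed.

Lemma eq_ip f g h k : {in X, f =1 g} -> {in X, h =1 k} -> ip mu X w f h = ip mu X w g k.
Proof. by move=> fg hk; apply: eq_Rintegral => x Xx; rewrite fg// hk. Qed.

Lemma ipC f g : ip mu X w f g = ip mu X w g f.
Proof. by apply: eq_Rintegral => x _; rewrite [f x * _]mulrC. Qed.

Lemma ipDl k l f f' g : Poly_le k X f -> Poly_le k X f' -> Poly_le l X g ->
  ip mu X w (fun x => f x + f' x) g = ip mu X w f g + ip mu X w f' g.
Proof.
move=> pf pf' pg; rewrite /ip -RintegralD//; last 2 first.
- exact: ip_integrable pf pg.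
- exact: ip_integrable pf' pg.
by apply: eq_Rintegral => x _; rewrite -mulrDl -mulrDl.
Qed.

Lemma ip_suml (I : finType) k l (a : I -> R) (f : I -> 'rV[R]_d -> R) g :
  (forall i, Poly_le k X (f i)) -> Poly_le l X g ->
  ip mu X w (fun x => \sum_i a i * f i x) g = \sum_i a i * ip mu X w (f i) g.
Proof.
move=> pf pg; have if_ i := ip_integrable (pf i) pg.
have iaf i : mu.-integrable X (EFin \o (fun x => a i * (f i x * g x * w x))).
  by have := integrableZl mX (a i) (if_ i); apply: eq_integrable.
rewrite /ip; under eq_bigr do rewrite -RintegralZl//.
(* [fine] commutes with sums only for finite values, which integrability supplies. *)
rewrite /Rintegral sum_fine => [|i _]; last exact: (integrable_fin_num mX (iaf i)).
rewrite -integral_sum//; congr fine; apply: eq_integral => x _.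
by rewrite sumEFin !mulr_suml; congr EFin; apply: eq_bigr => i _; rewrite !mulrA.
Qed.
End inner_product.

(** If the integral of [f * f * Omega] is 0, the integrand vanishes almost everywhere. The points of
    [bary_pos] where the polynomial is nonzero then form an open null set, hence none exist, and
    density of [bary_pos] concludes. *)
Lemma ip_Omega_definite k (v : 'I_d.+1 -> 'rV[R]_d) Omega f : affinely_independent v ->
  prob_density (lebesgue_rV d) (simplex v) Omega ->
  {ae lebesgue_rV d, forall x, (simplex v)° x -> 0 < Omega x} ->
  Poly_le k (simplex v) f ->
  0 <= ip_Omega v Omega f f /\
  (ip_Omega v Omega f f = 0 -> forall x, simplex v x -> f x = 0).
Proof.
move=> hv [iO O0 _] Opos pf; have mS := measurable_simplex hv.
have iff_ := ip_integrable mS (@subset_refl _ (simplex v)) iO pf pf.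
have mff := measurable_int _ iff_.
(* The density is nonnegative only almost everywhere; the absolute value makes the integrand
   nonnegative without changing the integral. *)
have E : ip_Omega v Omega f f =
    fine (\int[lebesgue_rV d]_(x in simplex v) `|(f x * f x * Omega x)%:E|)%E.
  rewrite /ip_Omega /ip /Rintegral; congr fine.
  apply: ae_eq_integral => //; first exact: measurableT_comp.
  apply: filterS O0 => x xO /xO Ox /=; congr EFin.
  by rewrite ger0_norm// mulr_ge0// -expr2 sqr_ge0.
split; first by rewrite E fine_ge0// integral_ge0.
rewrite E => I0.
have {I0} : (\int[lebesgue_rV d]_(x in simplex v) `|(f x * f x * Omega x)%:E| = 0)%E.
  (* As [fine] also sends infinities to 0, integrability is used to recover that the extended
     integral is 0. *)
  rewrite -(@fineK _ (integral _ _ _)) ?I0//.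
  by apply: integrable_fin_num => //; exact: integrable_abse iff_.
move=> /(ae_eq_integral_abs _ mS mff) ff0.
have [p cp fp] := Poly_le_continuous pf.
have op : open (p @^-1` [set t | t != 0]).
  by move/continuousP: cp; apply; exact: open_neq.
have U0 : bary_pos v `&` [set x | p x != 0] = set0.
  apply: (lebesgue_rV_negligible_open (N := ~` [set x | ((simplex v) x ->
     (f x * f x * Omega x)%:E = 0%E) /\ ((simplex v)° x -> 0 < Omega x)])).
  - by apply: filterI ff0 Opos.
  - apply: openI; first exact: open_bary_pos.
    exact: op.
  - move=> x [xpos /= px0] [ff Ox].
    have xi := bary_pos_interior hv xpos.
    have xS : simplex v x := interior_subset xi.
    have /eqP := ff xS; rewrite eqe mulf_eq0 (gt_eqF (Ox xi)) orbF mulf_eq0 orbb.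
    by rewrite fp ?inE// (negPf px0).
move=> x xS; rewrite fp ?inE//; apply: contrapT => /eqP px0.
(* If [p x] were nonzero, so would [p] be near [x], hence at some point of [bary_pos]. *)
have [|y [ypos yp]] := simplex_closure_bary_pos hv xS (B := [set x | p x != 0]).
  exact: open_nbhs_nbhs.
by suff : set0 y by []; rewrite -U0.
Qed.
End polynomials.

(** * Matrix form of the functionals, the Schur complement and the supremum *)

Section functionals.
Context {R : realType} {d : nat}.
Variables (v : 'I_d.+1 -> 'rV[R]_d) (Omega : 'rV[R]_d -> R)
  (omega : 'I_d.+1 -> 'rV[R]_d -> R)
  (rho : 'I_(dtilde d) -> 'rV[R]_d -> R) (psi q : 'I_d.+1 -> 'rV[R]_d -> R).
Hypotheses (hv : affinely_independent v)
  (hOmega : prob_density (lebesgue_rV d) (simplex v) Omega)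
  (hOmega_gt0 : {ae lebesgue_rV d, forall x, (simplex v)° x -> 0 < Omega x})
  (homega : forall j, prob_density (surface_measure v j) (face v j) (omega j))
  (hrho : forall k, Poly_le 2 (simplex v) (rho k))
  (hrho_indep : lin_indep (simplex v) rho)
  (hpsi : forall j, Poly_le 2 (simplex v) (psi j))
  (hq : forall j, Poly_le 2 (face v j) (q j))
  (hM : matM v omega psi q \in unitmx).

Local Notation X := (simplex v).
Local Notation G := (matG v Omega rho).
Local Notation C := (matC v Omega rho psi).
Local Notation Ct := (matCt v omega rho q).
Local Notation M := (matM v omega psi q).

Let face_simplex j : face v j `<=` X. Proof. by move=> x []. Qed.

(** The measure and the domain are left general to cover both the faces and the simplex. *)
Let ip_comb (mu : {measure set 'rV[R]_d -> \bar R}) (Y : set 'rV[R]_d) w k h f g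
    (a : 'cV[R]_(dtilde d)) (b : 'cV[R]_d.+1) :
  measurable Y -> Y `<=` X -> mu.-integrable Y (EFin \o w) -> Poly_le k Y h ->
  (forall x, X x -> f x = \sum_i a i 0 * rho i x) ->
  (forall x, X x -> g x = \sum_i b i 0 * psi i x) ->
  ip mu Y w (fun x => f x + g x) h =
  \sum_i a i 0 * ip mu Y w (rho i) h + \sum_i b i 0 * ip mu Y w (psi i) h.
Proof.
move=> mY YX iw ph fE gE.
have pr i : Poly_le 2 Y (rho i) by exact: Poly_leS (hrho i).
have pp i : Poly_le 2 Y (psi i) by exact: Poly_leS (hpsi i).
rewrite -(ip_suml (v := v) mY YX iw _ pr ph) -(ip_suml (v := v) mY YX iw _ pp ph).
rewrite -(ipDl (v := v) mY YX iw (Poly_le_sum _ pr) (Poly_le_sum _ pp) ph).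
by apply: eq_ip => // x /set_mem/YX Xx; rewrite fE// gE.
Qed.

Lemma funL_comb f g (a : 'cV_(dtilde d)) (b : 'cV_d.+1) j :
  (forall x, X x -> f x = \sum_i a i 0 * rho i x) ->
  (forall x, X x -> g x = \sum_i b i 0 * psi i x) ->
  funL v omega q j (fun x => f x + g x) = (Ct *m a + M *m b) j 0.
Proof.
move=> fE gE; have [iw _ _] := homega j.
rewrite /funL /ip_omega (ip_comb (measurable_face hv j) (@face_simplex j) iw (hq j) fE gE).
by rewrite !mxE; congr (_ + _); apply: eq_bigr => i _; rewrite mxE mulrC.
Qed.

Lemma funV_comb f g (a : 'cV_(dtilde d)) (b : 'cV_d.+1) k :
  (forall x, X x -> f x = \sum_i a i 0 * rho i x) ->
  (forall x, X x -> g x = \sum_i b i 0 * psi i x) ->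
  funV v Omega rho k (fun x => f x + g x) = (G *m a + C *m b) k 0.
Proof.
move=> fE gE; have [iw _ _] := hOmega.
rewrite /funV /ip_Omega (ip_comb (measurable_simplex hv) (@subset_refl _ X) iw (hrho k) fE gE).
by rewrite !mxE; congr (_ + _); apply: eq_bigr => i _; rewrite mxE mulrC.
Qed.

Lemma tr_matG : G^T = G.
Proof. by apply/matrixP => i j; rewrite !mxE /funV /ip_Omega ipC. Qed.

Lemma ip_Omega_comb f (a : 'cV_(dtilde d)) : (forall x, X x -> f x = \sum_i a i 0 * rho i x) ->
  ip_Omega v Omega f f = (a^T *m G *m a) 0 0.
Proof.
move=> fE; have [iw _ _] := hOmega.
have pf : Poly_le 2 X f.
  by have [c cE] := Poly_le_sum (fun i => a i 0) hrho; exists c => x Xx; rewrite fE// cE.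
have E h : Poly_le 2 X h -> ip_Omega v Omega f h = \sum_i a i 0 * ip_Omega v Omega (rho i) h.
  move=> ph; rewrite /ip_Omega.
  rewrite -(ip_suml (measurable_simplex hv) (@subset_refl _ X) iw _ hrho ph).
  by apply: eq_ip => // x /set_mem /fE.
rewrite E// -mulmxA mxE; apply: eq_bigr => i _; rewrite mxE; congr (_ * _).
rewrite /ip_Omega ipC -/(ip_Omega v Omega f (rho i)) E// mxE.
by apply: eq_bigr => j _; rewrite mxE mulrC.
Qed.

(** The form of [G] at [a] is the squared norm of the combination of the [rho i] with coefficients
    [a]; if it is 0, the combination vanishes on the simplex and independence gives [a = 0]. *)
Lemma matG_pdmx : pdmx G.
Proof.
split=> [|a a0]; first exact: tr_matG.
pose f x := \sum_i a i 0 * rho i x.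
rewrite -(ip_Omega_comb (f := f))//.
have [f_ge0 f_eq0] := ip_Omega_definite hv hOmega hOmega_gt0
  (Poly_le_sum (fun i => a i 0) hrho).
rewrite lt_def f_ge0 andbT; apply: contra a0 => /eqP/f_eq0 f0.
by apply/eqP/matrixP => i j; rewrite !ord1 mxE; exact: hrho_indep f0 i.
Qed.

(* The blocks K11, K12, K21, K22 are X^T N X, X^T N Y, Y^T N X, Y^T N Y for
   N = [dual_gram], X = [functionals_V] and Y = [functionals_W]. *)
Definition dual_gram : 'M[R]_(d.+1 + dtilde d) := block_mx (M^T *m M) 0 0 G.
Definition functionals_V : 'M[R]_(d.+1 + dtilde d, dtilde d) := col_mx Ct G.
Definition functionals_W : 'M[R]_(d.+1 + dtilde d, d.+1) := col_mx M C.

Lemma dual_gram_pdmx : pdmx dual_gram.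
Proof. by apply: block_diag_pdmx; [exact: mulmx_tr_pdmx|exact: matG_pdmx]. Qed.

(** [functionals_W] is injective because its upper block [M] is invertible. *)
Lemma K22_pdmx : pdmx (functionals_W^T *m dual_gram *m functionals_W).
Proof.
apply: gram_pdmx dual_gram_pdmx _ => x; rewrite mul_col_mx -[0]vsubmxK.
move=> /eq_col_mx[+ _]; rewrite (_ : usubmx 0 = 0); last by apply/matrixP => i j; rewrite !mxE.
by move=> /(congr1 (mulmx (invmx M))); rewrite mulKmx// mulmx0.
Qed.

Lemma matSE : matS v Omega omega rho psi q =
  functionals_V^T *m dual_gram *m functionals_V -
  functionals_V^T *m dual_gram *m functionals_W *m
  invmx (functionals_W^T *m dual_gram *m functionals_W) *m
  (functionals_W^T *m dual_gram *m functionals_V).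
Proof.
rewrite /matS /functionals_V /functionals_W /dual_gram.
rewrite !tr_col_mx !mul_row_block !mulmx0 !addr0 !add0r.
rewrite !mul_row_col tr_matG /K11 /K12 /K21 /K22.
by rewrite !exprS expr0 mulr1 -!mulmxE !mulmxA.
Qed.

(** [Psi] is the Euclidean pairing of the stacked column of [y] with the vector of functional
    values, and [normY0] comes from the form of [invmx dual_gram], so [pdmx_ratio_sup] applies. *)
Lemma sup_ratio f g (a : 'cV_(dtilde d)) (b : 'cV_d.+1) :
  (forall x, X x -> f x = \sum_i a i 0 * rho i x) ->
  (forall x, X x -> g x = \sum_i b i 0 * psi i x) ->
  ereal_sup [set (Psi v Omega omega rho q (fun x => f x + g x) y /
         normY0 v Omega omega rho psi q y)%:E | y in [set y | y != 0]] =
  (Num.sqrt (((functionals_V *m a + functionals_W *m b)^T *m dual_gram *m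
              (functionals_V *m a + functionals_W *m b)) 0 0))%:E.
Proof.
move=> fE gE; rewrite -pdmx_ratio_sup//; last exact: dual_gram_pdmx.
set z := _ + _.
have zE : z = col_mx (Ct *m a + M *m b) (G *m a + C *m b).
  by rewrite /z /functionals_V /functionals_W !mul_col_mx add_col_mx.
have E y1 y2 : Psi v Omega omega rho q (fun x => f x + g x) (y1, y2) /
    normY0 v Omega omega rho psi q (y1, y2) =
    ((col_mx y1 y2)^T *m z) 0 0 /
    Num.sqrt (((col_mx y1 y2)^T *m invmx dual_gram *m col_mx y1 y2) 0 0).
  congr (_ / Num.sqrt _).
    rewrite zE tr_col_mx mul_row_col mxE /Psi /=; congr (_ + _); rewrite mxE.
      by apply: eq_bigr => j _; rewrite (funL_comb _ fE gE) [y1^T _ _]mxE.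
    by apply: eq_bigr => j _; rewrite (funV_comb _ fE gE) [y2^T _ _]mxE.
  rewrite /dual_gram invmx_block_diag; last exact: pdmx_unit dual_gram_pdmx.
  by rewrite tr_col_mx mul_row_block !mulmx0 addr0 add0r mul_row_col [RHS]mxE.
congr ereal_sup; apply/seteqP; split => [_ [[y1 y2] /= y0 <-]|_ [y /= y0 <-]].
  exists (col_mx y1 y2); last by rewrite E.
  by apply: contra y0; rewrite col_mx_eq0 => /andP[/eqP -> /eqP ->].
exists (usubmx y, dsubmx y); last by rewrite E vsubmxK.
by apply: contra y0 => /eqP[u0 w0]; rewrite -[y]vsubmxK u0 w0 col_mx0.
Qed.

End functionals.

(** * The inf-sup constant as a smallest eigenvalue *)

Theorem theorem4 (R : realType) (d : nat) (hd : (2 <= d)%N)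
    (v : 'I_d.+1 -> 'rV[R]_d) (hv : affinely_independent v)
    (Omega : 'rV[R]_d -> R)
    (hOmega : prob_density (lebesgue_rV d) (simplex v) Omega)
    (hOmega_gt0 : {ae lebesgue_rV d, forall x, (simplex v)° x -> 0 < Omega x})
    (omega : 'I_d.+1 -> 'rV[R]_d -> R)
    (homega : forall j,
       prob_density (surface_measure v j) (face v j) (omega j))
    (homega_gt0 : forall j,
       {ae surface_measure v j, forall x, face v j x -> 0 < omega j x})
    (htrace : forall j, is_trace v Omega omega j)
    (rho : 'I_(dtilde d) -> 'rV[R]_d -> R)
    (hrho : forall k, S2 v Omega (rho k))
    (hrho_indep : lin_indep (simplex v) rho)
    (psi : 'I_d.+1 -> 'rV[R]_d -> R)
    (hpsi : forall j, S2 v Omega (psi j))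
    (hVW : direct_sum (simplex v) (S2 v Omega)
       (Span (simplex v) rho) (Span (simplex v) psi))
    (q : 'I_d.+1 -> 'rV[R]_d -> R)
    (hq : forall j, Poly_le 2 (face v j) (q j))
    (hq_orth : forall j phi, Poly_le 1 (face v j) phi ->
       ip_omega v omega j (q j) phi = 0)
    (hM : matM v omega psi q \in unitmx) :
  ereal_inf [set
    ereal_inf [set
      ereal_sup [set
        (Psi v Omega omega rho q (fun x => f x + g x) y /
         normY0 v Omega omega rho psi q y)%:E
        | y in [set y | y != 0]]
      | g in Span (simplex v) psi]
    | f in [set f | Span (simplex v) rho f /\ norm_Omega v Omega f = 1]]
  = sqrte (sigma_min (Shat (matG v Omega rho)
                           (matS v Omega omega rho psi q))).
Proof.
have pr k : Poly_le 2 (simplex v) (rho k) by have [] := hrho k.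
have pp j : Poly_le 2 (simplex v) (psi j) by have [] := hpsi j.
have pdG := matG_pdmx hv hOmega hOmega_gt0 pr hrho_indep.
have pdN := dual_gram_pdmx hv hOmega hOmega_gt0 pr hrho_indep hM.
have pdK := K22_pdmx hv hOmega hOmega_gt0 pr hrho_indep hM.
have SE := matSE v Omega omega rho psi q.
have supE := sup_ratio hv hOmega hOmega_gt0 homega pr hrho_indep pp hq hM.
set G := matG v Omega rho in pdG *; set S := matS _ _ _ _ _ _ in SE *.
move: pdN pdK SE supE; set N := dual_gram _ _ _ _ _ _.
set X := functionals_V _ _ _ _ _; set Y := functionals_W _ _ _ _ _ _.
move=> pdN pdK SE supE.
have [[symB _] BB] := sqrtmxP (pdmx_psdmx pdG).
set B := sqrtmx _ in symB BB.
have uB : B \in unitmx.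
  by have := pdmx_unit pdG; rewrite -BB unitmx_mul => /andP[].
have symV : (invmx B)^T = invmx B by rewrite trmx_inv symB.
have [symN _] := pdN; have uK := pdmx_unit pdK.
have symS : S^T = S.
  have [symK _] := pdK.
  rewrite SE linearB/= !trmx_mul trmx_inv symK !trmxK symN; congr (_ - _).
    by rewrite mulmxA.
  by rewrite !mulmxA.
have symH : (Shat G S)^T = Shat G S.
  by rewrite /Shat -/B !trmx_mul symV symS mulmxA.
have quadE a b := @schur_complement_form _ _ _ _ N X Y a b symN uK.
apply/eqP; rewrite eq_le; apply/andP; split.
  (* Upper bound. When [dtilde d] is 0 the right-hand side is infinite. *)
  have [n0|n_gt0] := posnP (dtilde d).
    suff -> : sigma_min (Shat G S) = +oo%E by rewrite leey.
    by move: (Shat G S); rewrite n0; exact: sigma_min0.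
  have [s [-> _ [x xx xs]]] := sigma_min_rayleigh n_gt0 symH.
  (* With [B] the square root of [G], the unit vector [x] minimizing the form of [Shat] yields
     coefficients [a] with [a^T *m G *m a = 1]; [b] is chosen to annihilate the completed square. *)
  pose a := invmx B *m x.
  pose b := - (invmx (Y^T *m N *m Y) *m (Y^T *m N *m X) *m a).
  pose f y := \sum_i a i 0 * rho i y; pose g y := \sum_i b i 0 * psi i y.
  have aGa : (a^T *m G *m a) 0 0 = 1.
    rewrite -BB /a trmx_mul symV !mulmxA mulmxKV// -(mulmxA _ B) mulmxV// mulmx1 xx.
    by rewrite mxE.
  apply: (@le_trans _ _ (ereal_inf [set ereal_sup [set
        (Psi v Omega omega rho q (fun x => f x + g x) y /
         normY0 v Omega omega rho psi q y)%:E | y in [set y | y != 0]]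
      | g in Span (simplex v) psi])).
    apply: ereal_inf_lbound; exists f => //; split; first by exists (a ^~ 0).
    by rewrite /norm_Omega (ip_Omega_comb hv hOmega pr (a := a))// aGa sqrtr1.
  apply: ereal_inf_lbound; exists g; first by exists (b ^~ 0).
  rewrite (supE f g a b)// quadE addNr mulmx0 addr0 -SE.
  by rewrite -xs /Shat -/B /a trmx_mul symV !mulmxA.
(* Lower bound, for arbitrary admissible [f] and [g]. *)
apply: le_ereal_inf_tmp => _ [f [[a' fE] nf] <-].
apply: le_ereal_inf_tmp => _ [g [b' gE] <-].
pose a : 'cV[R]_(dtilde d) := \col_i a' i; pose b : 'cV[R]_d.+1 := \col_i b' i.
have {}fE x : simplex v x -> f x = \sum_i a i 0 * rho i x.
  by move=> /fE ->; apply: eq_bigr => i _; rewrite mxE.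
have {}gE x : simplex v x -> g x = \sum_i b i 0 * psi i x.
  by move=> /gE ->; apply: eq_bigr => i _; rewrite mxE.
have aGa : (a^T *m G *m a) 0 0 = 1.
  have [_ G0] := pdmx_psdmx pdG.
  move: nf; rewrite /norm_Omega (ip_Omega_comb hv hOmega pr fE).
  by move=> /(congr1 (fun t => t ^+ 2)); rewrite sqr_sqrtr ?expr1n.
(* A coefficient vector of length 0 cannot have norm 1, so here the smallest eigenvalue is
   finite. *)
have n_gt0 : (0 < dtilde d)%N.
  rewrite lt0n; apply/negP => /eqP n0.
  by move: aGa => /eqP; rewrite mxE big1 ?(eq_sym 0) ?oner_eq0// => -[i ilt] _;
    exfalso; move: ilt; rewrite n0.
have [s [-> ray _]] := sigma_min_rayleigh n_gt0 symH.
rewrite (supE _ _ _ _ fE gE) lee_fin ler_wsqrtr// quadE -SE.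
(* The completed square is nonnegative and is dropped; the rest is the form of [Shat] at the unit
   vector [B *m a]. *)
set c := b + _; have [_ K0] := pdmx_psdmx pdK.
rewrite [leRHS]mxE ler_wpDr//.
have := ray (B *m a); rewrite trmx_mul symB !mulmxA -(mulmxA a^T B B) BB aGa mulr1.
by rewrite -/B mulmxK// mulmxKV.
Qed.
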